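(* There exists an absolute constant $c$ such that the following holds. Let $\mathfrak{L}_1,\mathfrak{L}_2,\mathfrak{L}_3$ be finite collections of $L_1$, $L_2$ and $L_3$, respectively, lines in $\mathbb{R}^3$. For all $(N_1,N_2,N_3)\in\mathbb{R}_+^3$, let $J'_{N_1,N_2,N_3}$ be the set of those multijoints $x$ formed by $\mathfrak{L}_1,\mathfrak{L}_2,\mathfrak{L}_3$ for which there exist collections $\mathfrak{L}_1(x)\subseteq\mathfrak{L}_1$, $\mathfrak{L}_2(x)\subseteq\mathfrak{L}_2$ and $\mathfrak{L}_3(x)\subseteq\mathfrak{L}_3$ of lines passing through $x$, such that $|\mathfrak{L}_1(x)|\geq N_1$, $|\mathfrak{L}_2(x)|\geq N_2$, $|\mathfrak{L}_3(x)|\geq N_3$ and, whenever $l_1\in\mathfrak{L}_1(x)$, $l_2\in\mathfrak{L}_2(x)$ and $l_3\in\mathfrak{L}_3(x)$, the directions of the lines $l_1,l_2,l_3$ span $\mathbb{R}^3$. Then $$|J'_{N_1,N_2,N_3}| \leq c\cdot \frac{(L_1L_2L_3)^{1/2}}{(N_1N_2N_3)^{1/2}}\qquad\text{for all } (N_1,N_2,N_3)\in\mathbb{R}_+^3.$$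
   Context: $\mathbb{R}_+$ denotes the positive real numbers. A collection of lines is a set of distinct lines. A point $x\in\mathbb{R}^3$ is a multijoint formed by $\mathfrak{L}_1,\mathfrak{L}_2,\mathfrak{L}_3$ if for each $i=1,2,3$ there exists a line $l_i\in\mathfrak{L}_i$ with $x\in l_i$, such that the directions of $l_1,l_2,l_3$ span $\mathbb{R}^3$. *)

(* Defs.v *)
From mathcomp Require Import all_boot all_order all_algebra finmap.
From mathcomp Require Import all_classical reals.

Set Implicit Arguments.
Unset Strict Implicit.
Unset Printing Implicit Defensive.

Import Order.TTheory GRing.Theory Num.Theory.

Local Open Scope classical_set_scope.
Local Open Scope ring_scope.

Section Multijoints.
Variable R : realType.

Definition R3 := 'rV[R]_3.

(* A line is identified with its set of points, so that distinct elements of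
   a collection of lines are distinct lines, whatever their parametrization. *)
Definition line_through (p v : R3) : set R3 :=
  [set p + t *: v | t in [set: R]].

(* A direction of a line is determined only up to a nonzero scalar. *)
Definition direction (l : set R3) (v : R3) : Prop :=
  v != 0 /\ exists p : R3, l = line_through p v.

Definition is_line (l : set R3) : Prop := exists v : R3, direction l v.

(* Directions of a given line being proportional, for lines l1, l2 and l3 the
   condition does not depend on the choice of v1, v2 and v3. *)
Definition directions_span (l1 l2 l3 : set R3) : Prop :=
  exists v1 v2 v3 : R3,
    [/\ direction l1 v1, direction l2 v2, direction l3 v3
      & <<[:: v1; v2; v3]>>%VS = fullv].

Definition multijoint (F1 F2 F3 : {fset set R3}) (x : R3) : Prop :=
  exists l1 l2 l3 : set R3,
    [/\ l1 \in F1 /\ l1 x, l2 \in F2 /\ l2 x, l3 \in F3 /\ l3 x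
      & directions_span l1 l2 l3].

Definition subcollection_through (F : {fset set R3}) (x : R3) (N : R)
    (G : {fset set R3}) : Prop :=
  [/\ (G `<=` F)%fset, (forall l, l \in G -> l x) & N <= #|` G|%:R].

Definition rich_multijoints (F1 F2 F3 : {fset set R3}) (N1 N2 N3 : R) :
    set R3 :=
  [set x | multijoint F1 F2 F3 x /\
    exists G1 G2 G3 : {fset set R3},
      [/\ subcollection_through F1 x N1 G1,
          subcollection_through F2 x N2 G2,
          subcollection_through F3 x N3 G3
        & forall l1 l2 l3 : set R3,
            l1 \in G1 -> l2 \in G2 -> l3 \in G3 -> directions_span l1 l2 l3]].

End Multijoints.

(* Main.v *)
(* Polynomial method with delays, in the style of Zhang and of Yu and Zhao.

   Give each multijoint p a delay be p and ask a polynomial to vanish at p to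
   order tau - be p at time tau.  A line is saturated at the first time T at
   which these orders add up to more than the degree along it.  In a frame
   carried by three lines through p, only the Taylor coefficients whose i-th
   exponent is less than T_i - be p, for T_i the saturation time of the i-th
   line, need be imposed at p: if another one has i-th exponent at least
   T_i - be p, the polynomial on the i-th axis formed by the coefficients with
   the same other exponents has too many zeros and vanishes.  So the boxes
   prod_i (T_i - be p) together have at least as many elements as the space of
   polynomials has dimensions.

   At each multijoint use, in each family, the line which saturates first.
   Delays minimal under an upper bound on the boxes make all boxes about
   equally large.  Now sum N_i * (T_i - be p) over the multijoints: each line
   of the i-th family contributes about the degree, and the AM-GM inequality
   concludes. *)
From HB Require Import structures.
Require Import Defs.
From mathcomp Require Import all_boot all_order all_algebra finmap.
From mathcomp Require Import all_classical reals.
From mathcomp Require Import mpoly zify.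

Set Implicit Arguments.
Unset Strict Implicit.
Unset Printing Implicit Defensive.

Import Order.TTheory GRing.Theory Num.Theory.

Local Open Scope ring_scope.

(** * Polynomials, Taylor expansions and vanishing along lines *)

Section Univariate.
Variable F : fieldType.

Lemma dvdp_coef_low (m : nat) (h : {poly F}) :
  (forall k, (k < m)%N -> h`_k = 0) -> 'X^m %| h.
Proof.
move=> h0; rewrite -(poly_take_drop m h) dvdp_addr ?dvdp_mull //.
suff -> : take_poly m h = 0 by rewrite dvdp0.
by apply/polyP=> k; rewrite coef_take_poly coef0; case: ifP => // /h0.
Qed.

(** Powers of distinct linear factors are coprime, so their product divides [h]. Its size is one
    more than the sum of the multiplicities, too large for a divisor of a nonzero [h]. *)
Lemma poly_eq0_of_multiple_roots (Q : finType) (A : {set Q}) (t : Q -> F)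
    (mu : Q -> nat) (h : {poly F}) :
  {in A &, injective t} ->
  (forall q, q \in A -> forall k, (k < mu q)%N -> (h \Po ('X + (t q)%:P))`_k = 0) ->
  (size h <= \sum_(q in A) mu q)%N -> h = 0.
Proof.
move=> injt root_h.
have dvdh q : q \in A -> ('X - (t q)%:P) ^+ mu q %| h.
  move=> /root_h/dvdp_coef_low/(dvdp_comp_poly ('X - (t q)%:P)).
  by rewrite comp_Xn_poly -comp_polyA comp_polyD comp_polyX comp_polyC subrK comp_polyXr.
suff dvd_prod : \prod_(q in A) ('X - (t q)%:P) ^+ mu q %| h.
  move=> szh; apply: contraTeq szh => h_neq0; rewrite -ltnNge.
  apply: leq_trans (dvdp_leq h_neq0 dvd_prod).
  rewrite size_prod => [|q _]; last by rewrite expf_neq0 ?polyXsubC_eq0.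
  have -> : (\sum_(q in A) size (('X - (t q)%:P) ^+ mu q)%R = \sum_(q in A) (mu q + 1))%N.
    by apply: eq_bigr => q _; rewrite size_exp_XsubC addn1.
  by rewrite big_split /= sum1_card subSn ?addnK // leq_addl.
rewrite -big_enum /=.
have: {subset enum A <= A} by move=> q; rewrite mem_enum.
elim: (enum A) (enum_uniq A) => [|q s IH] /=; first by rewrite big_nil dvd1p.
case/andP=> qs us sA; rewrite big_cons Gauss_dvdp ?dvdh ?sA ?mem_head //=.
  by apply: IH => // r rs; apply: sA; rewrite inE rs orbT.
rewrite big_seq; elim/big_rec: _ => [|r g rs cop]; first exact: coprimep1.
rewrite coprimepMr cop andbT; apply/coprimep_expl/coprimep_expr/coprimep_XsubC2.
rewrite subr_eq0; apply/eqP => /injt trq; move: qs; rewrite -trq ?rs //.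
  by apply: sA; rewrite inE rs orbT.
by apply: sA; rewrite mem_head.
Qed.

End Univariate.

(** * Taylor expansions in affine frames *)

Section Taylor.
Variables (F : fieldType) (n : nat).
Implicit Types (g h : {mpoly F[n]}) (p : 'rV[F]_n) (v : 'M[F]_n) (ga : 'X_{1..n}).

(** The substitution of [p + X *m v]: the rows of [v] are the axes of a frame at [p], and composing
    with it gives the Taylor coefficients at [p] in that frame. *)
Definition affine_map p v : n.-tuple {mpoly F[n]} :=
  [tuple (p 0 i)%:MP + \sum_j v j i *: 'X_j | i < n].

Definition linear_map v : n.-tuple {mpoly F[n]} :=
  [tuple \sum_j v j i *: 'X_j | i < n].

Definition taylor p v g := g \mPo affine_map p v.

Definition vanishes (m : nat) p v g :=
  forall ga, (mdeg ga < m)%N -> (taylor p v g)@_ga = 0.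

Lemma comp_mpolyA g (s t : n.-tuple {mpoly F[n]}) :
  (g \mPo s) \mPo t = g \mPo [tuple tnth s i \mPo t | i < n].
Proof.
rewrite [g \mPo s]comp_mpolyE [RHS]comp_mpolyE raddf_sum /=.
apply: eq_bigr => m _; rewrite comp_mpolyZ rmorph_prod /=; congr (_ *: _).
by apply: eq_bigr => i _; rewrite rmorphXn /= tnth_mktuple.
Qed.

Lemma comp_affine_linear p v w i :
  tnth (affine_map p v) i \mPo linear_map w = tnth (affine_map p (w *m v)) i.
Proof.
rewrite !tnth_mktuple raddfD raddf_sum /= comp_mpolyC; congr (_ + _).
under eq_bigr => j _ do
  rewrite comp_mpolyZ comp_mpolyXU -tnth_nth tnth_mktuple scaler_sumr.
rewrite exchange_big; apply: eq_bigr => j _ /=; rewrite mxE scaler_suml.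
by apply: eq_bigr => k _; rewrite scalerA mulrC.
Qed.

Lemma taylor_mul p v w g : taylor p (w *m v) g = taylor p v g \mPo linear_map w.
Proof.
rewrite /taylor comp_mpolyA; congr (_ \mPo _).
by apply: eq_from_tnth => i; rewrite tnth_mktuple comp_affine_linear.
Qed.

Lemma linear_prod_homog v (m : 'X_{1..n}) :
  \prod_i tnth (linear_map v) i ^+ m i \is (mdeg m).-homog.
Proof.
rewrite mdegE; elim/big_ind2: _ => [|a x b y ha hb|i _]; first exact: dhomog1.
  exact: dhomogM.
rewrite -[X in X.-homog]mul1n; apply: dhomogMn; rewrite tnth_mktuple.
apply: rpred_sum => j _; apply: rpredZ; rewrite dhomogX /= mdeg1 //.
Qed.

Lemma comp_linear_low (m : nat) v g :
  (forall ga, (mdeg ga < m)%N -> g@_ga = 0) ->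
  forall ga, (mdeg ga < m)%N -> (g \mPo linear_map v)@_ga = 0.
Proof.
move=> g0 ga ga_m; rewrite comp_mpolyE raddf_sum /= big_seq big1 // => mu.
rewrite mcoeff_msupp mcoeffZ => gmu; have mu_m : (m <= mdeg mu)%N.
  by rewrite leqNgt; apply: contra gmu => /g0->.
rewrite (dhomog_nemf_coeff (linear_prod_homog v mu)) ?mulr0 //=.
by rewrite neq_ltn (leq_trans ga_m mu_m).
Qed.

(** A change of frame is a linear substitution, which turns each monomial into a form of the same
    degree. This lets points on a common line carry different frames. *)
Lemma vanishes_frame (m : nat) p v w g :
  v \in unitmx -> vanishes m p v g -> vanishes m p w g.
Proof.
move=> v_unit vg ga; rewrite -[w](mulmxKV v_unit) taylor_mul.
exact: comp_linear_low.
Qed.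

(** Substituting [(X - p) *m invmx v] undoes the change of coordinates. *)
Lemma taylor_inj p v : v \in unitmx -> injective (taylor p v).
Proof.
move=> v_unit; have tK g : taylor p v g \mPo
    [tuple \sum_j (invmx v) j i *: ('X_j - (p 0 j)%:MP) | i < n] = g.
  rewrite /taylor comp_mpolyA -[RHS]comp_mpoly_id; congr (_ \mPo _).
  apply: eq_from_tnth => i; rewrite !tnth_mktuple raddfD raddf_sum /= comp_mpolyC.
  under eq_bigr => j _ do
    rewrite comp_mpolyZ comp_mpolyXU -tnth_nth tnth_mktuple scaler_sumr.
  rewrite exchange_big (bigD1 i) //= [X in _ + (_ + X)]big1 => [|j /negPf ji].
    rewrite addr0; under eq_bigr => j _ do rewrite scalerA mulrC.
    rewrite -scaler_suml; have := congr1 (fun A : 'M_n => A i i) (mulVmx v_unit).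
    by rewrite !mxE eqxx => ->; rewrite scale1r subrKC.
  under eq_bigr => k _ do rewrite scalerA mulrC.
  rewrite -scaler_suml; have := congr1 (fun A : 'M_n => A j i) (mulVmx v_unit).
  by rewrite !mxE ji => ->; rewrite scale0r.
exact: (@can_inj _ _ _ (fun x => x \mPo _) tK).
Qed.

Lemma msize_prod_le (I : Type) (r : seq I) (f : I -> {mpoly F[n]}) (c : I -> nat) :
  (forall i, msize (f i) <= (c i).+1)%N ->
  (msize (\prod_(i <- r) f i) <= (\sum_(i <- r) c i).+1)%N.
Proof.
move=> fc; apply: (big_ind2 (fun x k => msize x <= k.+1)%N) => //.
  by rewrite msize1.
move=> x a y b xa yb.
have [->|x0] := eqVneq x 0; first by rewrite mul0r msize0.
have [->|y0] := eqVneq y 0; first by rewrite mulr0 msize0.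
rewrite msizeM // -ltnS prednK; first by rewrite -addSn -addnS leq_add.
by rewrite addn_gt0 lt0n msize_poly_eq0 x0.
Qed.

Lemma msize_taylor p v g : (msize (taylor p v g) <= msize g)%N.
Proof.
rewrite /taylor comp_mpolyE big_seq.
apply: leq_trans (msize_sum _ _ _) _; apply/bigmax_leqP_seq => m _ /[dup] mg.
move=> /msize_mdeg_lt; apply: leq_trans; apply: leq_trans (msizeZ_le _ _) _.
rewrite mdegE; apply: msize_prod_le => i.
have H : (msize (tnth (affine_map p v) i) <= 2)%N.
  rewrite tnth_mktuple (leq_trans (msizeD_le _ _)) // geq_max msizeC.
  rewrite (leq_trans (leq_b1 _)) //= (leq_trans (msize_sum _ _ _)) //.
  apply/bigmax_leqP => j _; apply: leq_trans (msizeZ_le _ _) _.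
  by rewrite msizeX mdeg1.
(* The power is written as a product of [m i] factors of degree at most 1, to use the bound for
   products again. *)
rewrite -[m i]card_ord -prodr_const -sum1_card.
exact: msize_prod_le.
Qed.

End Taylor.

(** * Coefficients along one axis of a frame *)

Section Axis.
Variables (F : fieldType) (n : nat).
Implicit Types (g h : {mpoly F[n]}) (p : 'rV[F]_n) (v : 'M[F]_n) (ga m : 'X_{1..n}).

Definition mnm_set ga (i : 'I_n) (k : nat) : 'X_{1..n} :=
  [multinom if j == i then k else ga j | j < n].

Lemma mnm_set_id ga i : mnm_set ga i (ga i) = ga.
Proof. by apply/mnmP => j; rewrite mnmE; case: eqP => // ->. Qed.

Lemma mdeg_mset ga i k : (mdeg (mnm_set ga i k) = k + (mdeg ga - ga i))%N.
Proof.
rewrite !mdegE (bigD1 i) //= mnmE eqxx [in RHS](bigD1 i) //= addKn; congr addn.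
by apply: eq_bigr => j /negPf ji; rewrite mnmE ji.
Qed.

Lemma mnm_set_eq ga m i k l :
  (mnm_set m i k == mnm_set ga i l) = (k == l) && (mnm_set m i 0 == mnm_set ga i 0).
Proof.
apply/eqP/andP => [/mnmP E|[/eqP-> /eqP/mnmP E]].
  split; first by have := E i; rewrite !mnmE eqxx => ->.
  by apply/eqP/mnmP => j; have := E j; rewrite !mnmE; case: eqP.
by apply/mnmP => j; have := E j; rewrite !mnmE; case: eqP.
Qed.

(** The factor, polynomial in the [i]-th variable, of the monomial formed by the other exponents of
    [ga]. Truncating at [msize g] loses no coefficient. *)
Definition axis_poly (i : 'I_n) ga g : {poly F} :=
  \poly_(k < msize g) g@_(mnm_set ga i k).

Lemma coef_axis_poly i ga g k : (axis_poly i ga g)`_k = g@_(mnm_set ga i k).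
Proof.
rewrite coef_poly; case: ltnP => // gk; rewrite memN_msupp_eq0 //.
by apply: msize_mdeg_ge; rewrite (leq_trans gk) // mdeg_mset leq_addr.
Qed.

Lemma axis_poly_is_linear i ga : linear (axis_poly i ga).
Proof.
by move=> a g h; apply/polyP => k; rewrite coefD coefZ !coef_axis_poly mcoeffD mcoeffZ.
Qed.

HB.instance Definition _ i ga :=
  GRing.isLinear.Build F {mpoly F[n]} {poly F} _ (axis_poly i ga)
    (axis_poly_is_linear i ga).

Definition axis_shift (i : 'I_n) (t : F) : n.-tuple {mpoly F[n]} :=
  [tuple 'X_j + (if j == i then t else 0)%:MP | j < n].

Lemma axis_polyX i ga m :
  axis_poly i ga 'X_[m] = (mnm_set m i 0 == mnm_set ga i 0)%:R *: 'X^(m i).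
Proof.
apply/polyP => k; rewrite coef_axis_poly mcoeffX coefZ coefXn -natrM mulnb.
by rewrite -[m in LHS](mnm_set_id m i) mnm_set_eq andbC [k == _]eq_sym.
Qed.

Lemma axis_shiftX i t m :
  'X_[m] \mPo axis_shift i t =
  \sum_(b < (m i).+1) (t ^+ (m i - b) *+ 'C(m i, b)) *: 'X_[mnm_set m i b].
Proof.
rewrite comp_mpolyX (bigD1 i) //= tnth_mktuple eqxx addrC exprDn.
under eq_bigr => j /negPf ji do rewrite tnth_mktuple ji addr0.
rewrite mulr_suml; apply: eq_bigr => b _.
rewrite -rmorphXn /= -mulrnAl -mulrA -raddfMn /= mul_mpolyC; congr (_ *: _).
rewrite [RHS]mpolyXE_id [RHS](bigD1 i) //= mnmE eqxx; congr (_ * _).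
by apply: eq_bigr => j /negPf ji; rewrite mnmE ji.
Qed.

(** Translating the [i]-th variable leaves the other exponents alone, so it acts on each axis
    polynomial separately; by linearity, monomials suffice. *)
Lemma axis_poly_shift i ga t g :
  axis_poly i ga (g \mPo axis_shift i t) = axis_poly i ga g \Po ('X + t%:P).
Proof.
rewrite [in LHS](mpolyE g) [in RHS](mpolyE g).
rewrite (raddf_sum (comp_mpoly (axis_shift i t))) !raddf_sum /=; apply: eq_bigr => m _.
rewrite comp_mpolyZ !linearZ /= axis_polyX comp_polyZ comp_Xn_poly.
congr (_ *: _); rewrite axis_shiftX raddf_sum /= addrC exprDn scaler_sumr.
apply: eq_bigr => b _; rewrite linearZ /= axis_polyX mnmE eqxx.
rewrite scalerA mulrC -scalerA; congr (_%:R *: _).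
  rewrite mnm_set_eq eqxx -(mnm_set_eq _ _ _ 0 0); congr (_ == _).
  by apply/mnmP => j; rewrite !mnmE; case: eqP.
by rewrite -rmorphXn /= -mulrnAl -raddfMn /= mul_polyC.
Qed.

Lemma taylor_shift p v i t g :
  taylor (p + t *: row i v) v g = taylor p v g \mPo axis_shift i t.
Proof.
rewrite /taylor comp_mpolyA; congr (_ \mPo _).
apply: eq_from_tnth => k; rewrite !tnth_mktuple raddfD raddf_sum /= comp_mpolyC.
under [in RHS]eq_bigr => j _ do
  rewrite comp_mpolyZ comp_mpolyXU -tnth_nth tnth_mktuple scalerDr.
rewrite big_split /= [X in _ + (_ + X)](bigD1 i) //= eqxx.
rewrite [X in _ + (_ + (_ + X))]big1 => [|j /negPf->].
  by rewrite addr0 addrCA addrC !mxE raddfD /= -mul_mpolyC -mpolyCM [v i k * t]mulrC.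
by rewrite mpolyC0 scaler0.
Qed.

(* Along the axis, the coefficients with the other exponents fixed, of total
   degree s, form a univariate polynomial which at a point where g vanishes to
   order m vanishes to order m - s. *)
Lemma axis_coef_eq0 (Q : finType) (A : {set Q}) (t : Q -> F) (mu : Q -> nat)
    g p v i ga :
  {in A &, injective t} ->
  {in A, forall q, vanishes (mu q) (p + t q *: row i v) v g} ->
  (msize g <= \sum_(q in A) (mu q - (mdeg ga - ga i)))%N ->
  (taylor p v g)@_ga = 0.
Proof.
move=> injt van_g szg; rewrite -[ga](mnm_set_id ga i) -coef_axis_poly.
suff -> : axis_poly i ga (taylor p v g) = 0 by rewrite coef0.
apply: (poly_eq0_of_multiple_roots injt _ (leq_trans _ szg)).
  move=> q qA k kmu; rewrite -axis_poly_shift -taylor_shift coef_axis_poly.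
  by apply: (van_g q qA); rewrite mdeg_mset addnC -ltn_subRL.
by rewrite (leq_trans (size_poly _ _)) // msize_taylor.
Qed.

End Axis.

(** A matrix with more rows than columns has a nonzero left kernel. *)
Lemma underdetermined_system (F : fieldType) (I J : finType) (A : {pred J})
    (phi : I -> J -> F) :
  (#|A| < #|I|)%N ->
  exists2 a : I -> F, exists i, a i != 0
    & forall j, j \in A -> \sum_i a i * phi i j = 0.
Proof.
move=> ltAI; pose M := \matrix_(x < #|I|, y < #|A|) phi (enum_val x) (enum_val y).
have /rowV0Pn[w wM w0] : kermx M != 0.
  rewrite -mxrank_eq0 mxrank_ker -lt0n subn_gt0.
  exact: leq_ltn_trans (rank_leq_col M) ltAI.
exists (fun i => w 0 (enum_rank i)).
  by have /rV0Pn[x wx] := w0; exists (enum_val x); rewrite enum_valK.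
move=> j jA; have /sub_kermxP/matrixP/(_ 0 (enum_rank_in jA j)) := wM.
rewrite mxE [RHS]mxE => sum0; rewrite -[RHS]sum0.
rewrite [LHS](reindex (fun x : 'I_#|I| => enum_val x)) /=;
  last exact/onW_bij/enum_val_bij.
by apply: eq_bigr => x _; rewrite !mxE enum_valK enum_rankK_in.
Qed.

Lemma card_ord_lt (B b : nat) : (#|[pred x : 'I_B | (x < b)%N]| <= b)%N.
Proof.
have [bB|/ltnW Bb] := leqP b B; last by rewrite (leq_trans (max_card _)) ?card_ord.
by rewrite -sum1_card -(big_ord_widen B (fun _ => 1%N)) // sum1_card card_ord.
Qed.

(** * Counting the conditions imposed under delays *)

Section DelayCount.
Variables (F : fieldType) (n : nat) (P : finType) (pos : P -> 'rV[F]_n)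
  (frame : P -> 'M[F]_n) (S : {set P}) (axis : P -> 'I_n -> {set P})
  (be : P -> nat) (T : P -> 'I_n -> nat) (k : nat).
Hypotheses (pos_inj : injective pos)
  (frame_unit : forall p, p \in S -> frame p \in unitmx)
  (S_neq0 : exists p, p \in S)
  (axisP : forall p i q, p \in S -> q \in axis p i ->
     exists t, pos q = pos p + t *: row i (frame p))
  (saturated : forall p i, p \in S ->
     (n * k < \sum_(q in S :&: axis p i) (T p i - be q))%N).

(** Induction on [tau]. A coefficient outside the box has [ga i >= T p i - be p] for some [i], so
    its other exponents add up to at most [tau - T p i]. The order [tau - be q] known on the axis,
    less this sum, is still at least [T p i - be q]. *)
Lemma vanishes_by_delays (g : {mpoly F[n]}) :
  (msize g <= (n * k).+1)%N ->
  (forall p (ga : 'X_{1..n}), p \in S -> (forall i, ga i < T p i - be p)%N ->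
     (taylor (pos p) (frame p) g)@_ga = 0) ->
  forall tau p, p \in S -> vanishes (tau - be p) (pos p) (frame p) g.
Proof.
move=> szg g0; elim=> [|tau IH] p pS ga ga_tau; first by rewrite sub0n in ga_tau.
have [/forallP ga_T|] := boolP [forall i, (ga i < T p i - be p)%N]; first exact: g0.
rewrite negb_forall => /existsP[i]; rewrite -leqNgt => T_ga.
have /choice[t tP] : forall q, exists t, q \in S :&: axis p i ->
    pos q = pos p + t *: row i (frame p).
  move=> q; have [/finset.setIP[_ /(axisP pS)[t tq]]|_] := boolP (q \in S :&: axis p i).
    by exists t.
  by exists 0.
apply: (axis_coef_eq0 (A := S :&: axis p i) (t := t) (mu := fun q => (tau - be q)%N)
  (i := i)).
- by move=> q r qA rA tqr; apply: pos_inj; rewrite (tP q qA) (tP r rA) tqr.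
- move=> q qA; rewrite -tP //; have [qS _] := finset.setIP qA.
  by apply: vanishes_frame (frame_unit qS) (IH _ qS).
- apply: leq_trans szg (leq_trans (saturated i pS) _); apply: leq_sum => q _.
  have : (ga i <= mdeg ga)%N by rewrite mdegE (bigD1 i) //= leq_addr.
  by lia.
Qed.

(** With fewer conditions than the [k ^ n] monomials of exponents below [k], a nontrivial
    combination of these would satisfy them all and vanish to every order at a point. *)
Lemma delay_count : (k ^ n <= \sum_(p in S) \prod_i (T p i - be p))%N.
Proof.
rewrite leqNgt; apply/negP => few.
(* Bounds all exponents in the boxes, which thus live in a finite type. *)
pose B := (\sum_(p in S) \sum_i T p i)%N.
pose mon (f : {ffun 'I_n -> 'I_k}) : 'X_{1..n} := [multinom (f i : nat) | i < n].
pose mon' (f : {ffun 'I_n -> 'I_B}) : 'X_{1..n} := [multinom (f i : nat) | i < n].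
pose C := [pred c : P * {ffun 'I_n -> 'I_B} |
  (c.1 \in S) && [forall i, (c.2 i < T c.1 i - be c.1)%N]].
pose phi f (c : P * {ffun 'I_n -> 'I_B}) :=
  (taylor (pos c.1) (frame c.1) 'X_[mon f])@_(mon' c.2).
have [|a [f0 af0] aC] := @underdetermined_system F _ _ C phi.
  rewrite card_ffun !card_ord; apply: leq_ltn_trans few.
  rewrite -sum1_card (eq_bigl C) //.
  rewrite -(pair_big_dep (mem S) (fun p (f : {ffun 'I_n -> 'I_B}) =>
    [forall i, (f i < T p i - be p)%N]) (fun _ _ => 1%N)) /=.
  apply: leq_sum => p pS; rewrite sum1_card.
  rewrite (eq_card (B := family (fun i => [pred x : 'I_B | (x < T p i - be p)%N]))).
    rewrite card_family foldrE big_map enumT -/(index_enum _); apply: leq_prod => i _.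
    exact: card_ord_lt.
  by move=> f; rewrite !inE; apply/forallP/familyP => H i; have := H i; rewrite inE.
pose g : {mpoly F[n]} := \sum_f a f *: 'X_[mon f].
have mon_inj : injective mon.
  move=> f h /mnmP fh; apply/ffunP => i; apply/val_inj.
  by have := fh i; rewrite !mnmE.
have g_f0 : g@_(mon f0) = a f0.
  rewrite raddf_sum (bigD1 f0) //= mcoeffZ mcoeffX eqxx mulr1 big1 ?addr0 // => f ff0.
  by rewrite mcoeffZ mcoeffX (inj_eq mon_inj) (negPf ff0) mulr0.
have szg : (msize g <= (n * k).+1)%N.
  rewrite (leq_trans (msize_sum _ _ _)) //; apply/bigmax_leqP => f _.
  rewrite (leq_trans (msizeZ_le _ _)) // msizeX ltnS mdegE.
  rewrite -[n in leqRHS]card_ord -sum_nat_const leq_sum // => i _.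
  by rewrite mnmE ltnW.
have [p pS] := S_neq0.
have g0 : taylor (pos p) (frame p) g = 0.
  apply/mpolyP => ga; rewrite mcoeff0.
  (* At this time the order required at [p] is [mdeg ga + 1], so the coefficient at [ga] is
     reached. *)
  apply: (vanishes_by_delays szg _ (tau := (be p + mdeg ga).+1) pS); last by lia.
  move=> q gb qS gbT.
  have gbB i : (gb i < B)%N.
    rewrite (leq_trans (gbT i)) // (leq_trans (leq_subr _ _)) //.
    by rewrite /B (bigD1 q) //= (bigD1 i) //= -addnA leq_addr.
  pose f : {ffun 'I_n -> 'I_B} := [ffun i => Ordinal (gbB i)].
  have gbE : gb = mon' f by apply/mnmP => i; rewrite mnmE ffunE.
  rewrite gbE /taylor (raddf_sum (comp_mpoly _)) raddf_sum -[RHS](aC (q, f)).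
    by apply: eq_bigr => h _ /=; rewrite comp_mpolyZ mcoeffZ.
  by rewrite !inE /= qS; apply/forallP => i; rewrite ffunE /= gbT.
have : g = 0.
  by apply: (taylor_inj (p := pos p) (frame_unit pS)); rewrite g0 /taylor raddf0.
by move=> gE; move: af0; rewrite -g_f0 gE mcoeff0 eqxx.
Qed.

End DelayCount.

(** * Balanced delays *)

Section Saturation.
Variables (P : finType) (D : nat).
Implicit Types (A : {set P}) (be : P -> nat).
Local Open Scope nat_scope.

(** The search extends to [D + \sum_q be q + 1], when one point of [A] alone contributes more than
    [D]. For empty [A] the value is a default, hence the hypotheses [p \in A] below. *)
Definition saturation A be : nat :=
  find (fun tau => D < \sum_(q in A) (tau - be q)) (iota 0 (D + \sum_q be q).+2).

Lemma saturation_le A be p tau : p \in A ->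
  (saturation A be <= tau) = (D < \sum_(q in A) (tau - be q)).
Proof.
move=> pA; pose a t := D < \sum_(q in A) (t - be q); rewrite -/(a tau).
have a_mono s t : s <= t -> a s -> a t.
  by move=> st /leq_trans; apply; apply: leq_sum => q _; apply: leq_sub2r.
have a_max : a (D + \sum_q be q).+1.
  rewrite /a (bigD1 p) //= [in X in X - _ + _](bigD1 p) //=.
  have : forall x y z, D < (D + (x + y)).+1 - x + z by lia.
  exact.
have has_a : has a (iota 0 (D + \sum_q be q).+2).
  by apply/hasP; exists (D + \sum_q be q).+1; rewrite // mem_iota add0n leq0n ltnSn.
have sat_lt := has_a; rewrite has_find size_iota in sat_lt.
apply/idP/idP => [/a_mono|].
  apply; have := nth_find 0 has_a; rewrite nth_iota //.
move=> a_tau; rewrite leqNgt; apply/negP => tau_lt.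
have := before_find 0 tau_lt; rewrite nth_iota ?(ltn_trans tau_lt sat_lt) //.
by rewrite add0n -/(a tau) a_tau.
Qed.

Lemma saturation_ge A be p : p \in A ->
  D < \sum_(q in A) (saturation A be - be q).
Proof. by move=> pA; rewrite -(saturation_le _ _ pA). Qed.

(** By then [p] alone contributes [D.+1]. *)
Lemma saturation_near A be p : p \in A -> saturation A be <= be p + D.+1.
Proof.
move=> pA; rewrite (saturation_le _ _ pA) (bigD1 p) //= addKn.
exact: leq_addr.
Qed.

Lemma saturation_mono A be be' p : p \in A -> (forall q, be' q <= be q) ->
  saturation A be' <= saturation A be.
Proof.
move=> pA le_be; rewrite (saturation_le _ _ pA).
apply: leq_trans (saturation_ge _ pA) _.
by apply: leq_sum => q _; apply: leq_sub2l.
Qed.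

(** One time unit before saturation the sum is at most [D], and a unit adds at most 1 per point. *)
Lemma saturation_sum A be p : p \in A ->
  \sum_(q in A) (saturation A be - be q) <= D + #|P|.
Proof.
move=> pA; case E : (saturation A be) => [|t]; first by rewrite big1.
have : ~~ (saturation A be <= t) by rewrite E ltnn.
rewrite (saturation_le _ _ pA) -leqNgt => tD.
rewrite (leq_trans (n := \sum_(q in A) (t - be q + 1))) //.
  by apply: leq_sum => q _; lia.
by rewrite big_split /= sum1_card leq_add ?max_card.
Qed.

End Saturation.

(** * Choice of the lines and of the delays *)

Section Balancing.
Variables (I P L : finType) (G : P -> I -> {set L}) (l0 : P -> I -> L)
  (D K W : nat).
Hypothesis l0G : forall p i, l0 p i \in G p i.
Implicit Types (be : P -> nat).
Local Open Scope nat_scope.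

Definition through (i : I) (l : L) : {set P} := [set q | l \in G q i].

Definition first_line be p i : L :=
  [arg min_(l < l0 p i | l \in G p i) saturation D (through i l) be].

Definition first_time be p i := saturation D (through i (first_line be p i)) be.

Lemma first_lineP be p i : first_line be p i \in G p i.
Proof. by rewrite /first_line; case: arg_minnP. Qed.

Lemma first_line_through be p i : p \in through i (first_line be p i).
Proof. by rewrite inE first_lineP. Qed.

Lemma first_time_le be p i l :
  l \in G p i -> first_time be p i <= saturation D (through i l) be.
Proof. by rewrite /first_time /first_line; case: arg_minnP => // ? _; apply. Qed.

(** The first line may change with the delays; the one chosen for [be] already gives the bound. *)
Lemma first_time_mono be be' p i : (forall q, be' q <= be q) ->
  first_time be' p i <= first_time be p i.
Proof.
move=> le_be; apply: leq_trans (first_time_le _ (first_lineP be p i)) _.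
exact: saturation_mono (first_line_through _ _ _) le_be.
Qed.

(** The form of [delay_count] needed here, with [K] the number of monomials. It must hold for every
    [S], to be applied to the points below a gap. *)
Hypothesis count : forall (S : {set P}) be (c : P -> I -> L) (T : P -> I -> nat),
  (exists p, p \in S) -> (forall p i, p \in S -> c p i \in G p i) ->
  (forall p i, p \in S -> D < \sum_(q in S :&: through i (c p i)) (T p i - be q)) ->
  K <= \sum_(p in S) \prod_i (T p i - be p).

Hypothesis W_small : #|P| * W < K.

(* If the delays leave a gap, the points below it saturate all their lines
   before any point above it starts, so [count] applies to them alone. *)
Lemma delay_gap be M :
  #|P| * D.+1 <= M ->
  (forall p, be p = M \/ \prod_i (first_time be p i - be p) <= W) ->
  forall p, 0 < be p.
Proof.
move=> PDM small p; rewrite lt0n; apply/negP => /eqP be_p.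
(* Without a gap of length [D.+1], each of these sets loses a point of the previous one, so the one
   of index [#|P|] is empty; a point of delay 0 would lie in it. *)
pose S j := [set p | be p + j * D.+1 <= M].
have cardS j : #|S j| <= #|P| - j.
  elim: j => [|j IH]; first by rewrite subn0 max_card.
  have subS : S j.+1 \subset S j.
    apply/fintype.subsetP => q; rewrite !inE; apply: leq_trans.
    by rewrite leq_add2l leq_mul2r leqnSn orbT.
  have [S0|[q qS]] := set_0Vmem (S j.+1); first by rewrite S0 cards0.
  have [Sj|SN] := boolP (S j \subset S j.+1); last first.
    have : #|S j.+1| < #|S j| by apply/proper_card/andP.
    by lia.
  have := count (S := S j.+1) (be := be) (c := first_line be) (T := first_time be).
  suff few : \sum_(r in S j.+1) \prod_i (first_time be r i - be r) < K.
    move=> /(_ (ex_intro _ q qS) (fun r i _ => first_lineP be r i)) no_sat.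
    move: few; rewrite ltnNge => /negP[]; apply: no_sat => r i rS.
    apply: leq_trans (saturation_ge D be (first_line_through be r i)) _.
    rewrite -/(first_time be r i) (big_setID (S j.+1)) /= finset.setIC.
    rewrite [X in _ + X]big1 ?addn0 // => s; rewrite finset.inE => /andP[sS _].
    have sSj : s \notin S j by apply: contra sS; apply/fintype.subsetP.
    have := saturation_near D be (first_line_through be r i).
    rewrite -/(first_time be r i); move: rS sSj; rewrite !finset.inE mulSn.
    by lia.
  (* Points of [S j.+1] have delays strictly below [M], so their boxes have at most [W] elements. *)
  apply: leq_ltn_trans W_small; apply: leq_trans (_ : #|S j.+1| * W <= _).
    rewrite -sum_nat_const; apply: leq_sum => r; rewrite finset.inE => rS.
    by case: (small r) => // rM; move: rS; rewrite rM mulSn; lia.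
  by rewrite leq_mul2r max_card orbT.
have := cardS #|P|; rewrite subnn leqn0 cards_eq0 => /eqP/setP/(_ p).
by rewrite !finset.inE be_p PDM.
Qed.

(** Take delays of least total among those with each point at the cap [M] or with a box of at most
    [W]. If the enlarged box of [p] were still at most [W], lowering [be p] by 1 would be allowed:
    the sides at [p] grow by at most 1 and the other boxes do not grow. *)
Lemma balanced_delays :
  exists be, forall p, W < \prod_i (first_time be p i - be p).+1.
Proof.
pose M := #|P| * D.+1.
pose nb (be : {ffun P -> 'I_M.+1}) (p : P) : nat := be p.
pose inv (be : {ffun P -> 'I_M.+1}) := [forall p, (nb be p == M) ||
  (\prod_i (first_time (nb be) p i - nb be p) <= W)].
have inv0 : inv [ffun => ord_max] by apply/forallP => p; rewrite /nb ffunE eqxx.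
pose tot (be : {ffun P -> 'I_M.+1}) := \sum_p nb be p.
have [be inv_be min_be] := arg_minnP tot inv0.
exists (nb be) => p; rewrite ltnNge; apply/negP => small.
have be_gt0 : 0 < nb be p.
  apply: (@delay_gap (nb be) M) => // q.
  by case/orP: (forallP inv_be q) => [/eqP|]; [left|right].
have lt_be : (nb be p).-1 < M.+1 by rewrite (leq_ltn_trans (leq_pred _)) // /nb.
pose be' : {ffun P -> 'I_M.+1} := [ffun q => if q == p then Ordinal lt_be else be q].
have nb' q : nb be' q = if q == p then (nb be p).-1 else nb be q.
  by rewrite /nb ffunE; case: ifP.
have le_be q : nb be' q <= nb be q by rewrite nb'; case: eqP => // ->; apply: leq_pred.
have : tot be <= tot be'.
  apply/min_be/forallP => q; rewrite nb'; case: (eqVneq q p) => [->|qp].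
    apply/orP; right; apply: leq_trans small; apply: leq_prod => i _.
    have := first_time_mono p i le_be; lia.
  case/orP: (forallP inv_be q) => [->//|q_small]; apply/orP; right.
  apply: leq_trans q_small; apply: leq_prod => i _.
  exact/leq_sub2r/first_time_mono.
rewrite leqNgt => /negP[]; rewrite /tot (bigD1 p) //= [ltnRHS](bigD1 p) //=.
rewrite nb' eqxx -addSn prednK // leq_add2l.
by apply: leq_sum => q _; apply: le_be.
Qed.

End Balancing.

(** * Multijoints *)

(** The AM-GM inequality over [P] for each [i], raised to the power [#|P|] to avoid roots. *)
Lemma prod_sum_ge (R : realFieldType) (I P : finType) (B : P -> I -> R) (w : R) :
  (0 < #|P|)%N -> (forall p i, 0 <= B p i) -> 0 <= w ->
  (forall p, w <= \prod_i B p i) ->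
  w * #|P|%:R ^+ #|I| <= \prod_i \sum_p B p i.
Proof.
move=> P_gt0 B_ge0 w_ge0 wB; have m_gt0 : 0 < #|P|%:R :> R by rewrite ltr0n.
suff : w <= \prod_i ((\sum_p B p i) / #|P|%:R).
  by rewrite prodf_div prodr_const ler_pdivlMr ?exprn_gt0.
have prod_ge0 : 0 <= \prod_i ((\sum_p B p i) / #|P|%:R).
  by apply: prodr_ge0 => i _; rewrite divr_ge0 ?ler0n ?sumr_ge0.
rewrite -(ler_pXn2r P_gt0) ?nnegrE // -prodrXl.
apply: le_trans (_ : \prod_p \prod_i B p i <= _).
  by rewrite -[_ ^+ _]prodr_const; apply: ler_prod => p _; rewrite w_ge0 wB.
rewrite exchange_big; apply: ler_prod => i _; rewrite prodr_ge0 //=.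
by have [] := leif_AGM (A := P) (E := B ^~ i) (fun p _ => B_ge0 p i).
Qed.

Theorem generic_multijoints (R : realFieldType) (n : nat) (P L : finType)
    (pos : P -> 'rV[R]_n) (dir : L -> 'rV[R]_n) (F : 'I_n -> {set L})
    (G : P -> 'I_n -> {set L}) (N : 'I_n -> R) :
  (0 < n)%N -> (0 < #|P|)%N -> injective pos ->
  (forall p i, G p i \subset F i) ->
  (forall p q i l, l \in G p i -> l \in G q i ->
     exists t, pos q = pos p + t *: dir l) ->
  (forall p (c : 'I_n -> L), (forall i, c i \in G p i) ->
     \matrix_i dir (c i) \in unitmx) ->
  (forall i, 0 < N i) -> (forall p i, N i <= #|G p i|%:R) ->
  #|P|%:R ^+ n.-1 * \prod_i N i <= n.+1%:R ^+ n * \prod_i #|F i|%:R.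
Proof.
move=> n_gt0 m_gt0 pos_inj GF collinear spanning N_gt0 NG.
set m := #|P|.
have /choice[l0' l0G'] : forall pi : P * 'I_n, exists l, l \in G pi.1 pi.2.
  move=> [p i]; apply/set0Pn; rewrite -card_gt0 -(ltr0n R).
  exact: lt_le_trans (N_gt0 i) (NG p i).
pose l0 p i := l0' (p, i).
have l0G p i : l0 p i \in G p i by exact: l0G' (p, i).
(* With [k = 2 * m] exponents per variable, [W.+1] is [k ^ n / m]. The roundings cost at most
   [2 * m] per line, one more [k] beside the degree [n * k]: hence the factor [n.+1]. *)
pose W := (2 ^ n * m ^ n.-1).-1.
have W1 : W.+1 = (2 ^ n * m ^ n.-1)%N by rewrite prednK // muln_gt0 !expn_gt0 m_gt0.
have W_small : (#|P| * W < (2 * m) ^ n)%N.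
  rewrite expnMn -(prednK n_gt0) [(m ^ _)%N]expnS prednK // mulnCA -W1.
  by rewrite ltn_pmul2l.
have [S be c T nonempty cG sat|be be_W] :=
  balanced_delays (D := n * (2 * m)) l0G _ W_small.
  apply: (delay_count (pos := pos) (axis := fun p i => through G i (c p i))
    (frame := fun p => \matrix_i dir (c p i))) => //.
  - by move=> p pS; apply: spanning => i; apply: cG.
  - move=> p i q pS; rewrite finset.inE rowK; apply: collinear; exact: cG.
pose b p i := (first_time G l0 (n * (2 * m)) be p i - be p).+1.
have sum_b i : (\sum_p b p i)%:R * N i <= ((2 * m * n.+1) * #|F i|)%:R.
  apply: le_trans (_ : (\sum_p b p i * #|G p i|)%:R <= _).
    rewrite !natr_sum mulr_suml; apply: ler_sum => p _.
    by rewrite natrM ler_wpM2l.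
  rewrite ler_nat.
  (* The first time is at most the saturation time of every line of [G p i], so the sum extends to
     all these lines and can be regrouped line by line. *)
  apply: leq_trans (_ : \sum_p \sum_(l in G p i)
    (saturation (n * (2 * m)) (through G i l) be - be p).+1 <= _)%N.
    apply: leq_sum => p _; rewrite mulnC -sum_nat_const; apply: leq_sum => l lG.
    by rewrite ltnS leq_sub2r // first_time_le.
  rewrite (exchange_big_dep (mem (F i))) /= => [|p l _]; last first.
    exact: (fintype.subsetP (GF p i)).
  rewrite [leqRHS]mulnC -sum_nat_const; apply: leq_sum => l _.
  rewrite (eq_bigl (mem (through G i l))) => [|p]; last by rewrite !inE.
  have [->|[p pl]] := set_0Vmem (through G i l); first by rewrite big_set0.
  rewrite -(eq_bigr _ (fun q _ => addn1 _)) big_split /= sum1_card.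
  apply: leq_trans (leq_add (saturation_sum _ be pl) (max_card _)) _.
  by rewrite -/m; lia.
have := @prod_sum_ge R _ P (fun p i => (b p i)%:R) W.+1%:R m_gt0.
rewrite card_ord => /(_ (fun _ _ => ler0n _ _) (ler0n _ _)).
have bW p : W.+1%:R <= \prod_i (b p i)%:R :> R by rewrite -natr_prod ler_nat be_W.
move=> /(_ bW) low.
have : W.+1%:R * m%:R ^+ n * \prod_i N i <= (2 * m)%:R ^+ n *
    (n.+1%:R ^+ n * \prod_i #|F i|%:R).
  apply: le_trans (_ : (\prod_i \sum_p (b p i)%:R) * \prod_i N i <= _).
    by apply: ler_wpM2r low; apply: prodr_ge0 => i _; apply/ltW/N_gt0.
  rewrite -big_split /= mulrA -exprMn -natrM.
  rewrite -[n in _ ^+ n]card_ord -prodr_const -big_split /=; apply: ler_prod => i _.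
  by rewrite -natr_sum mulr_ge0 ?ler0n ?(ltW (N_gt0 i)) //= -natrM sum_b.
(* Here [W.+1 * m ^ n = (2 * m) ^ n * m ^ n.-1], and [(2 * m) ^ n] cancels. *)
rewrite W1 natrM natrX -[_ * _ * _ ^+ n]mulrAC -exprMn -natrM natrX -mulrA.
by rewrite ler_pM2l // exprn_gt0 // ltr0n muln_gt0.
Qed.

Local Open Scope classical_set_scope.
Local Open Scope ring_scope.

Lemma card_restrict (T : choiceType) (A B : {fset T}) :
  (A `<=` B)%fset -> #|[set x : B | val x \in A]%SET| = #|` A|.
Proof.
move=> AB; rewrite cardfE -(card_imset _ (@fincl_inj _ _ _ AB)).
apply: eq_card => x; rewrite finset.inE; apply/idP/imsetP => [xA|[y _ ->]].
  by exists [` xA]%fset => //; apply/val_inj.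
exact: (valP y).
Qed.

(** * Lines in space and their directions *)

Section Lines.
Variable R : realType.
Implicit Types (l : set (R3 R)) (v d p q : R3 R).

Lemma direction_collinear l d p q :
  direction l d -> l p -> l q -> exists t, q = p + t *: d.
Proof.
move=> [_ [o ->]] [s _ <-] [t _ <-]; exists (t - s).
by rewrite -addrA -scalerDl subrKC.
Qed.

Lemma direction_proportional l v d :
  direction l v -> direction l d -> exists b, v = b *: d.
Proof.
move=> [_ [p lE]] ld.
have lp : l p by rewrite lE; exists 0; rewrite // scale0r addr0.
have lpv : l (p + v) by rewrite lE; exists 1; rewrite // scale1r.
by have [b /addrI] := direction_collinear ld lp lpv; exists b.
Qed.

(** The vectors witnessing the span are multiples of the chosen directions [d i], which therefore
    generate the space too. *)
Lemma directions_span_unit (c : 'I_3 -> set (R3 R)) (d : 'I_3 -> R3 R) :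
  (forall i, direction (c i) (d i)) ->
  directions_span (c 0) (c 1) (c 2%:R) -> \matrix_i d i \in unitmx.
Proof.
move=> cd [v0 [v1 [v2 [cv0 cv1 cv2 span_v]]]].
rewrite -row_full_unit -sub1mx; apply/row_subP => i.
have : row i 1%:M \in <<[tuple v0; v1; v2]>>%VS by rewrite span_v memvf.
move=> /coord_span->; apply: summx_sub => j _; apply: scalemx_sub.
suff [b ->] : exists b, [:: v0; v1; v2]`_j = b *: d j.
  by apply: scalemx_sub; rewrite -[d j](rowK d j) row_sub.
apply: (@direction_proportional (c j)) => //.
by case: j => [[|[|[]]]] //= ?; [rewrite (_ : Ordinal _ = 0)|rewrite (_ : Ordinal _ = 1)
  |rewrite (_ : Ordinal _ = 2%:R)] => //; apply/val_inj.
Qed.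

(** Stated for finite subsets [J], because finiteness of the whole set is deduced from this
    bound. *)
Lemma card_rich_multijoints (F1 F2 F3 : {fset set (R3 R)}) (N1 N2 N3 : R)
    (J : {fset R3 R}) :
  (forall l, l \in F1 -> is_line l) ->
  (forall l, l \in F2 -> is_line l) ->
  (forall l, l \in F3 -> is_line l) ->
  0 < N1 -> 0 < N2 -> 0 < N3 ->
  [set` J] `<=` rich_multijoints F1 F2 F3 N1 N2 N3 ->
  #|` J|%:R <= 8%:R * (Num.sqrt (#|` F1|%:R * #|` F2|%:R * #|` F3|%:R)
           / Num.sqrt (N1 * N2 * N3)).
Proof.
move=> line1 line2 line3 N1_gt0 N2_gt0 N3_gt0 rich.
have [J0|J_gt0] := posnP #|` J|.
  by rewrite J0 mulr_ge0 // divr_ge0 // sqrtr_ge0.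
pose Fs (i : 'I_3) := nth fset0 [:: F1; F2; F3] i.
pose N (i : 'I_3) := nth 0 [:: N1; N2; N3] i.
pose L := (F1 `|` F2 `|` F3)%fset.
have N_gt0 i : 0 < N i by case: i => [[|[|[]]]].
have FsL i : (Fs i `<=` L)%fset.
  apply/fsubsetP => l; case: i => [[|[|[]]]] //= ?;
    by rewrite /Fs /= !in_fsetU => ->; rewrite ?orbT.
have /choice[dir dirP] (l : L) : exists d, direction (val l) d.
  by have := valP l; rewrite !in_fsetU => /orP[/orP[/line1|/line2]|/line3].
have /choice[G GP] (p : J) : exists G : 'I_3 -> {fset set (R3 R)},
    (forall i, subcollection_through (Fs i) (val p) (N i) (G i)) /\
    (forall c : 'I_3 -> set (R3 R), (forall i, c i \in G i) ->
      directions_span (c 0) (c 1) (c 2%:R)).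
  have [_ [G1 [G2 [G3 [sub1 sub2 sub3 span]]]]] := rich _ (valP p).
  exists (fun i => nth fset0 [:: G1; G2; G3] i); split.
    by case=> [[|[|[]]]].
  by move=> c cG; apply: span; [apply: (cG 0)|apply: (cG 1)|apply: (cG 2%:R)].
have GF (p : J) i l : l \in G p i -> l \in Fs i.
  by have [/(_ i)[/fsubsetP sub _ _] _] := GP p; apply: sub.
pose restrict (A : {fset set (R3 R)}) : {set L} := [set l | val l \in A]%SET.
have := @generic_multijoints R 3 J L val dir (fun i => restrict (Fs i))
  (fun (p : J) i => restrict (G p i)) N isT.
rewrite -cardfE => /(_ J_gt0 val_inj).
rewrite !(eq_bigr _ (fun i _ => congr1 _ (card_restrict (FsL i)))).
rewrite !big_ord_recl !big_ord0 /Fs /N /= !mulr1 !mulrA => count.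
have {}count : #|` J|%:R ^+ 2 * (N1 * N2 * N3) <=
    8%:R ^+ 2 * (#|` F1|%:R * #|` F2|%:R * #|` F3|%:R).
  (* The constant 8 is the square root of [n.+1 ^ n] at [n = 3]. *)
  have -> : 8%:R ^+ 2 = 4%:R ^+ 3 :> R by rewrite -!natrX.
  rewrite !mulrA; apply: count => //.
  - by move=> p i; apply/fintype.subsetP => l; rewrite !finset.inE; apply: GF.
  - move=> p q i l; rewrite !finset.inE => pl ql; apply: direction_collinear (dirP l) _ _.
      by have [/(_ i)[_ + _] _] := GP p; apply.
    by have [/(_ i)[_ + _] _] := GP q; apply.
  - move=> p c cG; apply: (directions_span_unit (c := fun i => val (c i))) => [i|].
      exact: dirP.
    have [_ span] := GP p; apply: (span (fun i => val (c i))) => i.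
    by have := cG i; rewrite finset.inE.
  - move=> p i; have [/(_ i)[sub _ +] _] := GP p; rewrite card_restrict //.
    by apply: fsubset_trans sub _; apply: FsL.
have N_pos : 0 < N1 * N2 * N3 by rewrite !mulr_gt0.
rewrite ler_pdivlMr ?sqrtr_gt0 //.
rewrite -ler_sqr ?nnegrE ?mulr_ge0 ?sqrtr_ge0 //.
by rewrite !exprMn !sqr_sqrtr ?(ltW N_pos) // -!natrM ler0n.
Qed.

End Lines.

Theorem proposition1p2p2 (R : realType) :
  exists c : R,
  forall F1 F2 F3 : {fset set (R3 R)},
    (forall l, l \in F1 -> is_line l) ->
    (forall l, l \in F2 -> is_line l) ->
    (forall l, l \in F3 -> is_line l) ->
  forall N1 N2 N3 : R, 0 < N1 -> 0 < N2 -> 0 < N3 ->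
    finite_set (rich_multijoints F1 F2 F3 N1 N2 N3) /\
    #|` fset_set (rich_multijoints F1 F2 F3 N1 N2 N3)|%:R <=
      c * (Num.sqrt (#|` F1|%:R * #|` F2|%:R * #|` F3|%:R)
           / Num.sqrt (N1 * N2 * N3)).
Proof.
exists 8%:R => F1 F2 F3 line1 line2 line3 N1 N2 N3 N1_gt0 N2_gt0 N3_gt0.
have bound := card_rich_multijoints line1 line2 line3 N1_gt0 N2_gt0 N3_gt0.
have fin : finite_set (rich_multijoints F1 F2 F3 N1 N2 N3).
  (* An infinite set would contain a finite subset larger than the uniform bound. *)
  apply: contrapT => /(infinite_set_fset (Num.bound (8%:R *
    (Num.sqrt (#|` F1|%:R * #|` F2|%:R * #|` F3|%:R) / Num.sqrt (N1 * N2 * N3))))).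
  move=> [J /bound JB]; apply/negP; rewrite -ltnNge -(ltr_nat R).
  apply: le_lt_trans JB (archi_boundP _).
  by rewrite mulr_ge0 // divr_ge0 // sqrtr_ge0.
by split=> //; apply: bound; rewrite fset_setK.
Qed.
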